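(* Let $\Phi=(G,\varphi)$ be a $\mathbb{T}$-gain graph and $w:E(G)\to\mathbb{R}^{+}$ a weight function, and let $\Phi_w=(G,\varphi,w)$ be the associated positively weighted $\mathbb{T}$-gain graph. Then $A(\Phi_w)$ and $A(G_w)$ have the same spectrum if and only if $\Phi$ is balanced.
   Context: $\mathbb{T}=\{z\in\mathbb{C}:|z|=1\}$. A $\mathbb{T}$-gain graph $\Phi=(G,\varphi)$ on a simple graph $G$ with vertices $v_1,\dots,v_n$ assigns to each oriented edge $\overrightarrow{e}_{i,j}$ an element $\varphi(\overrightarrow{e}_{i,j})\in\mathbb{T}$ with $\varphi(\overrightarrow{e}_{j,i})=\varphi(\overrightarrow{e}_{i,j})^{-1}$. The gain of an oriented cycle is the product of the gains of its consecutive oriented edges; $\Phi$ is balanced if every cycle has gain $1$. For $w:E(G)\to\mathbb{R}^+$, $A(\Phi_w)$ is the $n\times n$ Hermitian matrix whose $(i,j)$ entry is $\varphi(\overrightarrow{e}_{i,j})w(e_{i,j})$ if $v_i\sim v_j$ and $0$ otherwise; $A(G_w)$ is the same matrix with $\varphi\equiv1$, i.e. the weighted adjacency matrix of $(G,w)$. *)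

(* Defs.v *)
From HB Require Import structures.
From mathcomp Require Import all_boot all_order all_algebra.
From mathcomp Require Import complex reals.

Set Implicit Arguments.
Unset Strict Implicit.
Unset Printing Implicit Defensive.

Import Order.TTheory GRing.Theory Num.Theory.
Local Open Scope ring_scope.
Local Open Scope complex_scope.

Record sgraph (n : nat) := SGraph {
  adj :> rel 'I_n;
  adj_sym : symmetric adj;
  adj_irr : irreflexive adj
}.

Definition edges (n : nat) (G : sgraph n) : {set {set 'I_n}} :=
  [set [set p.1; p.2] | p : 'I_n * 'I_n & G p.1 p.2].

(* Only the values on adjacent pairs (the oriented edges of G) are meaningful. *)
Record gain (R : realType) (n : nat) (G : sgraph n) := Gain {
  gain_val :> 'I_n -> 'I_n -> R[i];
  gain_norm : forall i j, G i j -> `|gain_val i j| = 1;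
  gain_inv : forall i j, G i j -> gain_val j i = (gain_val i j)^-1
}.

Fact gain1_norm (R : realType) (n : nat) (G : sgraph n) (i j : 'I_n) :
  G i j -> `|1 : R[i]| = 1.
Proof. by move=> _; exact: normr1. Qed.

Fact gain1_inv (R : realType) (n : nat) (G : sgraph n) (i j : 'I_n) :
  G i j -> (1 : R[i]) = 1^-1.
Proof. by rewrite invr1. Qed.

Definition gain1 (R : realType) (n : nat) (G : sgraph n) : gain R G :=
  @Gain R n G (fun _ _ => 1) (@gain1_norm R n G) (@gain1_inv R n G).

(* An oriented cycle is a duplicate-free cyclic sequence of at least three
   vertices, so next c x is the vertex following x on c. *)
Definition is_cycle (n : nat) (G : sgraph n) (c : seq 'I_n) : bool :=
  (2 < size c)%N && ucycleb G c.

Definition cycle_gain (R : realType) (n : nat) (G : sgraph n) (phi : gain R G)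
    (c : seq 'I_n) : R[i] :=
  \prod_(x <- c) phi x (next c x).

Definition balanced (R : realType) (n : nat) (G : sgraph n) (phi : gain R G)
    : Prop :=
  forall c : seq 'I_n, is_cycle G c -> cycle_gain phi c = 1.

Definition gain_adjmx (R : realType) (n : nat) (G : sgraph n) (phi : gain R G)
    (w : {set 'I_n} -> R) : 'M[R[i]]_n :=
  \matrix_(i, j) (if G i j then phi i j * (w [set i; j])%:C else 0).

Definition wadjmx (R : realType) (n : nat) (G : sgraph n)
    (w : {set 'I_n} -> R) : 'M[R[i]]_n :=
  gain_adjmx (gain1 R G) w.

(* The eigenvalues listed with algebraic multiplicity, in an arbitrary order:
   compare spectra with perm_eq. *)
Definition spectrum (R : realType) (n : nat) (A : 'M[R[i]]_n) : seq R[i] :=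
  sval (closed_field_poly_normal (char_poly A)).

Definition same_spectrum (R : realType) (n : nat) (A B : 'M[R[i]]_n) : bool :=
  perm_eq (spectrum A) (spectrum B).

(* Main.v *)
Require Import Defs.
From HB Require Import structures.
From mathcomp Require Import all_boot all_order all_algebra.
From mathcomp Require Import complex reals.
From mathcomp Require Import perm spectral ring.

Set Implicit Arguments.
Unset Strict Implicit.
Unset Printing Implicit Defensive.

Import Order.TTheory GRing.Theory Num.Theory.
Local Open Scope ring_scope.

(** If the spectra agree, so do the traces of all powers of the two Hermitian
    matrices.  The entries of [A(Phi_w)^k] are sums over walks of length [k] of
    complex numbers whose moduli sum up to the entries of [A(G_w)^k], so
    equality of the traces is an equality case of the triangle inequality and
    forces every closed walk, in particular every cycle, to have gain [1].
    Conversely, in the Leibniz expansion of the characteristic polynomial the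
    gains contribute to the term of a permutation the product of the gains of
    its cycles; this is [1] for balanced gains, orbits of size two being
    traversed once in each direction. *)

Lemma char_poly_similar {F : fieldType} {n} (P A B : 'M[F]_n) :
  P \in unitmx -> A = invmx P *m B *m P -> char_poly A = char_poly B.
Proof.
move=> uP ->; rewrite /char_poly.
have -> : char_poly_mx (invmx P *m B *m P) =
    map_mx polyC (invmx P) *m char_poly_mx B *m map_mx polyC P.
  rewrite /char_poly_mx mulmxBr mulmxBl !map_mxM; congr (_ - _).
  by rewrite scalar_mxC -mulmxA -map_mxM mulVmx // map_mx1 mulmx1.
rewrite !det_mulmx mulrAC -det_mulmx -map_mxM mulVmx // map_mx1 det1.
by rewrite mul1r.
Qed.

Lemma expmx_similar {F : fieldType} {n} (P A B : 'M[F]_n) k :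
  P \in unitmx -> A = invmx P *m B *m P -> A ^+ k = invmx P *m B ^+ k *m P.
Proof.
move=> uP AE; elim: k => [|k IH]; first by rewrite !expr0 mulmx1 mulVmx.
by rewrite exprS IH AE exprS -!mulmxE !mulmxA mulmxK.
Qed.

Lemma expmx_diag {F : fieldType} {n} (d : 'rV[F]_n) k :
  diag_mx d ^+ k = diag_mx (map_mx (fun x => x ^+ k) d).
Proof.
elim: k => [|k IH].
  by rewrite expr0; apply/matrixP=> i j; rewrite !mxE expr0.
rewrite exprS IH -mulmxE mulmx_diag; congr diag_mx.
by apply/rowP=> i; rewrite !mxE exprS.
Qed.

Lemma char_poly_spectrum {R : realType} {n} (A : 'M[R[i]]_n) :
  char_poly A = \prod_(z <- spectrum A) ('X - z%:P).
Proof.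
rewrite /spectrum; case: closed_field_poly_normal => r /= {1}->.
by rewrite (eqP (char_poly_monic A)) scale1r.
Qed.

Lemma same_spectrumP {R : realType} {n} (A B : 'M[R[i]]_n) :
  reflect (char_poly A = char_poly B) (same_spectrum A B).
Proof.
rewrite !char_poly_spectrum; apply: (iffP idP) => [|/prod_XsubC_eq //].
exact: perm_big.
Qed.

(** A normal matrix is unitarily diagonalizable. Similarity preserves the characteristic polynomial,
    which identifies the diagonal with [spectrum A] up to order, and the traces of powers. *)
Lemma tr_exp_spectrum {R : realType} {n} (A : 'M[R[i]]_n) k :
  A \is normalmx -> \tr (A ^+ k) = \sum_(z <- spectrum A) z ^+ k.
Proof.
move=> /orthomx_spectralP; have := spectral_unit A.
move: (spectralmx A) (spectral_diag A) => P d uP AE.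
have /prod_XsubC_eq eqs : \prod_(z <- spectrum A) ('X - z%:P) =
    \prod_(z <- [seq d 0 i | i <- enum 'I_n]) ('X - z%:P).
  rewrite -char_poly_spectrum (char_poly_similar uP AE) char_poly_trig.
    by rewrite big_map big_enum; apply: eq_bigr => i _; rewrite mxE eqxx.
  exact: diag_mx_is_trig.
rewrite (perm_big _ eqs) (expmx_similar k uP AE) mxtrace_mulC mulmxA mulmxV // mul1mx.
rewrite expmx_diag mxtrace_diag big_map big_enum.
by apply: eq_bigr => i _; rewrite mxE.
Qed.

Section GainGraph.

Variables (R : realType) (n : nat) (G : sgraph n).
Implicit Types (phi : gain R G) (w : {set 'I_n} -> R).

(** The inverse of a gain of modulus one is its conjugate, and weights are real and indexed by
    unordered pairs, so the matrix is Hermitian. Gain [1] gives the case of [wadjmx]. *)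
Lemma gain_adjmx_normal phi w : gain_adjmx phi w \is normalmx.
Proof.
apply/hermitian_normalmx/is_hermitianmxP/matrixP => i j.
rewrite expr0 scale1r !mxE adj_sym; case: ifP => Gij; last by rewrite rmorph0.
rewrite rmorphM (gain_inv phi Gij) invC_norm gain_norm // expr1n invr1 mul1r.
rewrite setUC; congr (_ * _); apply/esym/conj_Creal.
by apply/complex_realP; exists (w [set j; i]).
Qed.

Definition walk_gain phi x p := \prod_(z <- pairmap phi x p) z.

Lemma cycle_gain_walk phi x p :
  uniq (x :: p) -> cycle_gain phi (x :: p) = walk_gain phi x (rcons p x).
Proof.
move=> Uc; rewrite /cycle_gain /walk_gain -(big_map _ predT id).
congr bigop; apply: (@eq_from_nth _ 0) => [|i].
  by rewrite size_map size_pairmap size_rcons.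
rewrite size_map => lt_i.
(* With [x] as default, [nth] past the end of [p] returns the start, just as [next] wraps around. *)
rewrite (nth_map x) // (nth_pairmap x) ?size_rcons // nth_rcons_default.
rewrite next_nth mem_nth // index_uniq //; congr (phi _ _).
by case: i lt_i => //= i lt_i; rewrite nth_rcons ifT.
Qed.

(** A fixed point contributes [1], an orbit of size two a gain times its inverse, and a longer orbit
    is a cycle of [G]. *)
Lemma prod_orbit_gain phi (s : {perm 'I_n}) r :
  balanced phi -> (forall i, s i != i -> G i (s i)) ->
  \prod_(i <- fingraph.orbit s r) (if s i == i then 1 else phi i (s i)) = 1.
Proof.
move=> bal Gs.
have := cycle_orbit (@perm_inj _ s) r; have := orbit_uniq s r.
have [fix_r|move_r] := eqVneq (s r) r.
  move=> _ _; apply: big1_seq => i /=; rewrite -fconnect_orbit => /iter_findex <-.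
  by rewrite iter_fix // fix_r eqxx.
(* Cancelling iterates of the injective [s] carries a fixed point of the orbit back to [r]. *)
have moved i : i \in fingraph.orbit s r -> s i != i.
  rewrite -fconnect_orbit => /iter_findex <-; move: (findex s r i) => k.
  by rewrite -iterS iterSr inj_eq //; elim: k => // k IH x y /perm_inj/IH.
have [o_le2|o_gt2] := leqP (size (fingraph.orbit s r)) 2; last first.
  move=> Uo Co.
  have gain1o : cycle_gain phi (fingraph.orbit s r) = 1.
    apply: bal; rewrite /is_cycle o_gt2 /ucycleb Uo andbT /=.
    apply: cycle_from_next => // x xo.
    by rewrite (nextE Co xo); apply/Gs/moved.
  rewrite -[RHS]gain1o; apply: eq_big_seq => x xo.
  by rewrite (nextE Co xo) (negPf (moved x xo)).
move: o_le2 moved; rewrite size_orbit /fingraph.orbit -orderSpred.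
case: (order s r).-1 => [|[|//]] _ moved _ /=.
  by rewrite andbT (negPf move_r).
rewrite andbT => /andP[_ /eqP ssr].
rewrite !big_cons big_nil mulr1 ssr (negPf move_r) eq_sym (negPf move_r).
have Gr := Gs _ move_r.
by rewrite (gain_inv phi Gr) mulfV // -normr_eq0 gain_norm ?oner_eq0.
Qed.

Lemma prod_perm_gain phi (s : {perm 'I_n}) :
  balanced phi -> (forall i, s i != i -> G i (s i)) ->
  \prod_i (if s i == i then 1 else phi i (s i)) = 1.
Proof.
move=> bal Gs; rewrite (partition_big (froot s) (froots s)) /=; last first.
  by move=> i _; exact/roots_root/fconnect_sym/perm_inj.
apply: big1 => r /eqP rr; rewrite -[RHS](prod_orbit_gain r bal Gs).
rewrite [RHS]big_uniq ?orbit_uniq //; apply: eq_bigl => i /=.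
rewrite -{1}rr root_connect; last exact/fconnect_sym/perm_inj.
by rewrite fconnect_sym -?fconnect_orbit //; exact: perm_inj.
Qed.

Lemma balanced_char_poly phi w :
  balanced phi -> char_poly (gain_adjmx phi w) = char_poly (wadjmx G w).
Proof.
move=> bal; rewrite /char_poly /determinant; apply: eq_bigr => s _.
congr (_ * _); set B := char_poly_mx (wadjmx G w).
(* The factor is [1] on the diagonal, where both characteristic matrices have the entry ['X]. *)
pose c i j := if j == i then 1 else phi i j.
have entryE i j : char_poly_mx (gain_adjmx phi w) i j = (c i j)%:P * B i j.
  rewrite /B /c !mxE eq_sym; have [->|ne] := eqVneq i j.
    by rewrite adj_irr mul1r.
  by rewrite !mulr0n !sub0r mulrN -polyCM; case: ifP; rewrite ?mulr0 ?mul1r.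
under eq_bigr do rewrite entryE.
rewrite big_split /= -rmorph_prod /=.
have [/forallP Gs|] := boolP [forall i, (s i != i) ==> G i (s i)].
  by rewrite prod_perm_gain ?mul1r // => i; exact/implyP.
(* Here [s] moves [k] along a non-edge, so its term vanishes on both sides. *)
rewrite negb_forall => /existsP[k]; rewrite negb_imply => /andP[ne nG].
suff -> : \prod_i B i (s i) = 0 by rewrite mulr0.
by rewrite (bigD1 k) //= {1}/B !mxE eq_sym (negPf ne) (negPf nG) subr0 mul0r.
Qed.

Variables (phi : gain R G) (w : {set 'I_n} -> R).
Hypothesis w_gt0 : forall e, e \in edges G -> 0 < w e.
Let A := gain_adjmx phi w.
Let B := wadjmx G w.

Lemma weight_gt0 i j : G i j -> 0 < w [set i; j].
Proof. by move=> Gij; apply/w_gt0/imsetP; exists (i, j); rewrite ?inE. Qed.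

Lemma norm_gain_adjmx i j : `|A i j| = B i j.
Proof.
rewrite !mxE; case: ifP => [Gij|_]; last exact: normr0.
by rewrite normrM gain_norm // ger0_norm // ler0c ltW ?weight_gt0.
Qed.

Lemma norm_expmx_gain_adjmx k i j : `|(A ^+ k) i j| <= (B ^+ k) i j.
Proof.
elim: k i => [|k IH] i; first by rewrite !expr0 !mxE normr_nat.
rewrite !exprS -!mulmxE !mxE; apply: le_trans (ler_norm_sum _ _ _) _.
apply: ler_sum => l _.
by rewrite normrM norm_gain_adjmx ler_wpM2l // -norm_gain_adjmx.
Qed.

(** Induction on the walk with the phase [z] general: after the first step to [y], the rest is again
    extremal, with phase [z / phi x y]. Positive weights allow the cancellation. *)
Lemma walk_gain_extremal z x p : `|z| = 1 -> path G x p ->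
  (A ^+ size p) x (last x p) = z * (B ^+ size p) x (last x p) ->
  walk_gain phi x p = z.
Proof.
elim: p x z => [|y p IH] x z z1 /=.
  by rewrite /walk_gain big_nil !expr0 !mxE eqxx mulr1.
move=> /andP[Gxy Gp]; set j := last y p; set k := size p in IH *.
have nz : z != 0 by rewrite -normr_eq0 z1 oner_eq0.
have nphi : phi x y != 0 by rewrite -normr_eq0 gain_norm ?oner_eq0.
(* Rotating by [z^-1] makes the sum over the next vertex equal to the sum of the bounds on its
   terms, which forces equality term by term. *)
rewrite !exprS -!mulmxE !mxE => /(congr1 ( *%R z^-1)); rewrite mulKf //.
rewrite mulr_sumr => /normC_sum_upper/(_ y isT) ext.
have {ext} : z^-1 * (A x y * (A ^+ k) y j) = B x y * (B ^+ k) y j.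
  apply: ext => l _; rewrite !normrM normfV z1 invr1 mul1r norm_gain_adjmx.
  by rewrite ler_wpM2l ?norm_expmx_gain_adjmx // -norm_gain_adjmx.
have wxy : (w [set x; y])%:C%C != 0 :> R[i].
  by rewrite (inj_eq (@complexI R)) gt_eqF ?weight_gt0.
rewrite {1}/A {1}/B !mxE Gxy mul1r => ext.
rewrite /walk_gain /= big_cons -/(walk_gain phi y p).
rewrite (IH y (z / phi x y)) //.
- by rewrite mulrC divfK.
- by rewrite normrM normfV z1 gain_norm // divr1.
apply: (mulfI nphi); apply: (mulfI wxy); apply: (mulfI (invr_neq0 nz)).
rewrite -/j; transitivity ((w [set x; y])%:C%C * (B ^+ k) y j).
  by rewrite -ext; ring.
by field; rewrite nz nphi.
Qed.

(** The diagonal of [B ^+ k] dominates that of [A ^+ k] in modulus, so equal traces force equal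
    diagonals, and every cycle is an extremal closed walk of phase [1]. *)
Lemma tr_expmx_balanced : (forall k, \tr (A ^+ k) = \tr (B ^+ k)) -> balanced phi.
Proof.
move=> trE [|x p] /andP[// _ /andP[Gc Uc]]; rewrite cycle_gain_walk //.
apply: walk_gain_extremal Gc _; rewrite ?normr1 // mul1r last_rcons.
exact: (normC_sum_upper (fun i _ => norm_expmx_gain_adjmx _ i i) (trE _)).
Qed.


End GainGraph.

Theorem theorem4p4 (R : realType) (n : nat) (G : sgraph n) (phi : gain R G)
  (w : {set 'I_n} -> R) (w_gt0 : forall e, e \in edges G -> 0 < w e) :
  same_spectrum (gain_adjmx phi w) (wadjmx G w) <-> balanced phi.
Proof.
split=> [eq_sp|bal]; last exact/same_spectrumP/balanced_char_poly.
apply: (tr_expmx_balanced w_gt0) => k.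
by rewrite !tr_exp_spectrum ?gain_adjmx_normal // (perm_big _ eq_sp).
Qed.
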